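(* The Hatcher maps of a simplicial map are cubical. That is, if $f\colon K\to L$ is a simplicial map, then for all $r,q\in L$ with $r>q$ the Hatcher map $f_{rq}\colon f^{-1}(r)\to f^{-1}(q)$ is a cubical map.
   Context: For an element $p$ of a poset $P$ let $\lceil p\rceil=\lceil p\rceil_P=\{x\in P: x\le p\}$, the cone of $p$. A monotone map $f\colon P\to Q$ of posets is closed if $f(\lceil p\rceil)=\lceil f(p)\rceil$ for every $p\in P$. A subposet $F$ of $P$ is full in $P$ if for every $p\in P$ the intersection $\lceil p\rceil_P\cap F$ is either empty or a cone $\lceil x\rceil_F$ of $F$. A monotone map $f\colon P\to Q$ is full if $f^{-1}(q)$ is full in $P$ for every $q\in Q$. For a set $S$, $\Delta^S$ is the poset of nonempty subsets of $S$ ordered by inclusion (a simplex). A simplicial poset is a poset in which every cone is isomorphic to a simplex and every nonempty subset having an upper bound has a least upper bound (a simplicial complex is a countable simplicial poset with finite cones). A simplicial map is a closed monotone map between simplicial posets; such a map is full. Hatcher maps: let $f\colon P\to Q$ be a closed full map of posets and write $F_q=f^{-1}(q)$. If $p\in P$ and $q<f(p)$, then $\lceil p\rceil_P\cap F_q=\lceil p_q\rceil_{F_q}$ for a unique $p_q\in F_q$. For $r>q$ in $Q$ the Hatcher map $f_{rq}\colon F_r\to F_q$ is the monotone map $p\mapsto p_q$ (the unique map from the empty poset if $F_r=\emptyset$). Cubical map: for a poset $X$, $CX$ is the poset obtained from $X$ by adjoining a greatest element; $X\times Y$ carries the product order. A monotone map $f\colon P\to Q$ of posets is cubical if for every $p\in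 P$ the restriction $\lceil p\rceil\to\lceil f(p)\rceil$ of $f$ is isomorphic to the projection $CX\times CY\to CX$ for some posets $X$ and $Y$. *)

(* Defs.v *)
From HB Require Import structures.
From mathcomp Require Import all_boot all_order.
From mathcomp Require Import boolp classical_sets.

Set Implicit Arguments.
Unset Strict Implicit.
Unset Printing Implicit Defensive.
Set Warnings "-redundant-canonical-projection".

Import Order.TTheory.
Local Open Scope order_scope.
Local Open Scope classical_set_scope.

(* A subposet of [T] is a set [A : set T]; through the coercion [set_type],
   which is [{x : T | x \in A}], it is itself a poset for the order induced
   from [T]. *)
HB.instance Definition _ (d : Order.disp_t) (T : porderType d) (P : pred T) :=
  [SubChoice_isSubPOrder of {x : T | P x} by <: with d].

Definition cone (d : Order.disp_t) (P : porderType d) (p : P) : set P :=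
  [set x | x <= p].

Definition is_iso (d d' : Order.disp_t) (P : porderType d) (Q : porderType d')
    (phi : P -> Q) : Prop :=
  bijective phi /\ {mono phi : x y / x <= y}.

Definition isomorphic (d d' : Order.disp_t)
    (P : porderType d) (Q : porderType d') : Prop :=
  exists phi : P -> Q, is_iso phi.

Definition isomorphic_maps (dA dB dA' dB' : Order.disp_t)
    (A : porderType dA) (B : porderType dB)
    (A' : porderType dA') (B' : porderType dB')
    (g : A -> B) (g' : A' -> B') : Prop :=
  exists (phi : A -> A') (psi : B -> B'),
    [/\ is_iso phi, is_iso psi & forall x, psi (g x) = g' (phi x)].

(* [set S] carries the inclusion order, see [subsetEset]. *)
Definition simplex (S : Type) : set (set S) := [set A | A !=set0].
Arguments simplex : clear implicits.

Definition simplicial_poset (d : Order.disp_t) (P : porderType d) : Prop :=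
  (forall p : P, exists S : Type, isomorphic (cone p) (simplex S)) /\
  (forall A : set P, A !=set0 -> has_ubound A -> supremums A !=set0).

Definition full_subposet (d : Order.disp_t) (P : porderType d) (F : set P)
    : Prop :=
  forall p : P, cone p `&` F = set0 \/
    exists x : F, cone p `&` F = val @` cone x.

Section Maps.
Context (d d' : Order.disp_t) (P : porderType d) (Q : porderType d').
Implicit Type f : {omorphism P -> Q}.

Definition closed_map f : Prop := forall p : P, f @` cone p = cone (f p).

Definition fibre f (q : Q) : set P := f @^-1` [set q].

Definition full_map f : Prop := forall q : Q, full_subposet (fibre f q).

Definition simplicial_map f : Prop :=
  [/\ simplicial_poset P, simplicial_poset Q & closed_map f].

Lemma cone_restr_subproof f (p : P) (x : cone p) : f (val x) \in cone (f p).
Proof. by apply/mem_set; apply: omorph_le; exact: (set_mem (valP x)). Qed.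

Definition cone_restr f (p : P) (x : cone p) : cone (f p) :=
  exist _ (f (val x)) (cone_restr_subproof f x).

End Maps.

(* [with_top X] adjoins the greatest element [None] to [X]. *)
Definition with_top (X : Type) : Type := option X.

HB.instance Definition _ (X : choiceType) := Choice.on (with_top X).

Section WithTop.
Context (d : Order.disp_t) (X : porderType d).

Definition with_top_le (x y : with_top X) : bool :=
  match x, y with
  | _, None => true
  | None, Some _ => false
  | Some a, Some b => a <= b
  end.

Lemma with_top_le_refl : reflexive with_top_le.
Proof. by case=> [a|] /=. Qed.

Lemma with_top_le_anti : antisymmetric with_top_le.
Proof. by move=> [a|] [b|] //= /le_anti ->. Qed.

Lemma with_top_le_trans : transitive with_top_le.
Proof. by move=> [b|] [a|] [c|] //=; exact: le_trans. Qed.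

HB.instance Definition _ := Order.Le_isPOrder.Build d (with_top X)
  with_top_le_refl with_top_le_anti with_top_le_trans.

End WithTop.

(* [A *p B] is the product with the componentwise order. *)
Definition cubical (d d' : Order.disp_t)
    (P : porderType d) (Q : porderType d') (f : {omorphism P -> Q}) : Prop :=
  forall p : P, exists (dX dY : Order.disp_t)
      (X : porderType dX) (Y : porderType dY),
    isomorphic_maps (cone_restr f (p := p))
      (fst : with_top X *p with_top Y -> with_top X).

Section Hatcher.
Context (d d' : Order.disp_t) (P : porderType d) (Q : porderType d').
Context (f : {omorphism P -> Q}) (f_closed : closed_map f).
Context (f_full : full_map f).

Lemma hatcher_point_exists (p : P) (q : Q) : q < f p ->
  exists! x : fibre f q, cone p `&` fibre f q = val @` cone x.
Proof.
move=> qfp; have [e|[x ex]] := f_full q p.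
  have : (f @` cone p) q by rewrite f_closed /cone /= ltW.
  by case=> z zp fz; have : set0 z by rewrite -e; split.
exists x; split=> // y ey.
have sub (u v : fibre f q) : val @` cone u `<=` val @` cone v -> u <= v.
  move=> uv; have [w wv /val_inj <- //] : (val @` cone v) (val u).
    by apply: uv; exists u; rewrite /cone /=.
by apply/le_anti/andP; split; apply: sub; rewrite -ex -ey.
Qed.

Context (r q : Q) (qr : q < r).

Lemma hatcher_subproof (p : fibre f r) : q < f (val p).
Proof. by have := set_mem (valP p); rewrite /fibre /= => ->. Qed.

(* The map [p |-> p_q]. *)
Definition hatcher_fun (p : fibre f r) : fibre f q :=
  sval (cid (hatcher_point_exists (hatcher_subproof p))).

Lemma hatcher_funP (p : fibre f r) :
  cone (val p) `&` fibre f q = val @` cone (hatcher_fun p).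
Proof. by rewrite /hatcher_fun; case: cid => x []. Qed.

Lemma hatcher_fun_homo : {homo hatcher_fun : x y / x <= y}.
Proof.
move=> x y xy.
have : (cone (val x) `&` fibre f q) (val (hatcher_fun x)).
  by rewrite hatcher_funP; exists (hatcher_fun x); rewrite /cone /=.
case=> xp xF.
have : (cone (val y) `&` fibre f q) (val (hatcher_fun x)).
  by split=> //; exact: le_trans xp xy.
by rewrite hatcher_funP => -[z zy /val_inj <-].
Qed.

HB.instance Definition _ :=
  Order.isOrderMorphism.Build _ _ _ _ hatcher_fun hatcher_fun_homo.

Definition hatcher : {omorphism fibre f r -> fibre f q} := hatcher_fun.

End Hatcher.

Section SimplicialFull.
Context (d d' : Order.disp_t) (P : porderType d) (Q : porderType d').

Definition minimal (d0 : Order.disp_t) (T : porderType d0) (a : T) : Prop :=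
  forall b, b <= a -> b = a.

(* Vertices of a simplicial poset, read off the isomorphism of a cone
   with a simplex: for every element [s] of the vertex set there is a
   minimal element, and these determine the order. *)
Lemma simplicial_vertices (d0 : Order.disp_t) (T : porderType d0) (p : T) :
  simplicial_poset T ->
  exists (S : Type) (A : T -> set S) (B : set S -> T),
    [/\ forall x, x <= p -> A x !=set0,
        forall x y, x <= p -> y <= p -> (x <= y) <-> (A x `<=` A y) &
        forall X, X !=set0 -> B X <= p /\ A (B X) = X].
Proof.
case=> /(_ p)[S [phi [[psi phiK psiK] mphi]]] _.
have inC x : x <= p -> x \in cone p by move=> ?; apply/mem_set.
pose A x : set S := if pselect (x <= p) is left h
  then val (phi (exist _ x (inC _ h))) else set0.
have AE x (h : x <= p) : A x = val (phi (exist _ x (inC _ h))).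
  by rewrite /A; case: pselect => // h'; rewrite (bool_irrelevance h' h).
pose B X : T := if pselect (X !=set0) is left h
  then val (psi (exist _ X (mem_set (h : simplex S X)))) else p.
exists S, A, B; split.
- by move=> x h; rewrite (AE _ h); exact: (set_mem (valP (phi _))).
- move=> x y hx hy; rewrite (AE _ hx) (AE _ hy) -subsetEset.
  by rewrite -[X in _ <-> X]/(is_true (phi _ <= phi _)) mphi.
- move=> X hX; rewrite /B; case: pselect => // h.
  set u := psi _.
  have up : val u <= p by exact: (set_mem (valP u)).
  split=> //; rewrite (AE _ up).
  have -> : exist _ (val u) (inC _ up) = u :> cone p by exact: val_inj.
  by rewrite /u psiK.
Qed.

Lemma simplicial_vertex_notin (d0 : Order.disp_t) (T : porderType d0)
    (x y p : T) :
  simplicial_poset T -> x <= p -> y <= p -> ~ x <= y ->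
  exists a, [/\ minimal a, a <= x & ~ a <= y].
Proof.
move=> sT xp yp nxy.
have [S [A [B [A0 Ale AB]]]] := simplicial_vertices p sT.
have [s [xs ys]] : exists s, A x s /\ ~ A y s.
  apply: contrapT => h; apply: nxy; apply/(Ale _ _ xp yp) => s xs.
  by apply: contrapT => ys; apply: h; exists s.
have [ap Aa] := AB [set s] (ex_intro _ s erefl).
exists (B [set s]); split.
- move=> b ba; have bp := le_trans ba ap.
  apply/le_anti; rewrite ba /=; apply/(Ale _ _ ap bp).
  have [t bt] := A0 _ bp.
  have := (Ale _ _ bp ap).1 ba t bt; rewrite Aa /= => ts.
  by move=> _ ->; rewrite -ts.
- by apply/(Ale _ _ ap xp); rewrite Aa => _ ->.
- by move/(Ale _ _ ap yp); rewrite Aa => /(_ s erefl).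
Qed.

Lemma simplicial_vertex (d0 : Order.disp_t) (T : porderType d0) (x : T) :
  simplicial_poset T -> exists a, minimal a /\ a <= x.
Proof.
move=> sT; case: (pselect (minimal x)) => [mx|nx]; first by exists x.
have [b [bx nb]] : exists b, b <= x /\ ~ x <= b.
  apply: contrapT => h; apply: nx => b bx; apply/le_anti; rewrite bx /=.
  by apply: contrapT => nxb; apply: h; exists b.
by have [a [ma ax _]] := simplicial_vertex_notin sT (lexx x) bx nb; exists a.
Qed.

Lemma simplicial_vertex_sup (d0 : Order.disp_t) (T : porderType d0)
    (X : set T) (m a : T) :
  simplicial_poset T -> X !=set0 -> supremums X m -> minimal a -> a <= m ->
  exists2 x, X x & a <= x.
Proof.
move=> sT [x0 Xx0] [ubm lbm] mina am.
apply: contrapT => h.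
have [S [A [B [A0 Ale AB]]]] := simplicial_vertices m sT.
have [s As] := A0 _ am.
have nX x : X x -> ~ A x s.
  move=> Xx xs; apply: h; exists x => //.
  have [bm Ab] := AB [set s] (ex_intro _ s erefl).
  have <- : B [set s] = a.
    by apply: mina; apply/(Ale _ _ bm am); rewrite Ab => _ ->.
  by apply/(Ale _ _ bm (ubm _ Xx)); rewrite Ab => _ ->.
have sub x : X x -> A x `<=` ~` [set s].
  by move=> Xx t xt /= ts; apply: (nX _ Xx); rewrite -ts.
have ne : ~` [set s] !=set0.
  by have [t x0t] := A0 _ (ubm _ Xx0); exists t; exact: sub x0t.
have [bm Ab] := AB _ ne.
have mb : m <= B (~` [set s]).
  apply: lbm => x Xx; apply/(Ale _ _ (ubm _ Xx) bm); rewrite Ab; exact: sub.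
have := (Ale _ _ am bm).1 (le_trans am mb) s As.
by rewrite Ab; exact.
Qed.

Lemma simplicial_map_closed (f : {omorphism P -> Q}) :
  simplicial_map f -> closed_map f.
Proof. by case. Qed.

Lemma simplicial_map_full (f : {omorphism P -> Q}) :
  simplicial_map f -> full_map f.
Proof.
case=> sP sQ cf q p.
set X := cone p `&` fibre f q.
have [[x0 Xx0]|e] := pselect (X !=set0); last first.
  by left; apply/eqP/negPn/negP => /set0P.
right.
have [m supm] : supremums X !=set0.
  by apply: sP.2; [exists x0|exists p => x []].
have [ubm lbm] := supm.
have mp : m <= p by apply: lbm => x [].
have qm : q <= f m.
  by case: (Xx0) => _ <-; apply: omorph_le; exact: ubm.
have fm : f m = q.
  apply/le_anti; rewrite qm andbT; apply: contrapT => nmq.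
  have [v [minv vm nvq]] := simplicial_vertex_notin sQ (lexx _) qm nmq.
  have : (f @` cone m) v by rewrite cf.
  case=> b bm fb.
  have [a [mina ab]] := simplicial_vertex b sP.
  have fav : f a = v by apply: minv; rewrite -fb; exact: omorph_le.
  have [x Xx ax] := simplicial_vertex_sup sP (ex_intro _ x0 Xx0) supm mina
    (le_trans ab bm).
  by apply: nvq; rewrite -fav; case: (Xx) => _ <-; exact: omorph_le.
have mF : m \in fibre f q by apply/mem_set.
exists (exist _ m mF); apply/seteqP; split=> x.
  move=> Xx; have xF : x \in fibre f q by case: Xx => _ ?; apply/mem_set.
  by exists (exist _ x xF) => //; exact: ubm.
case=> y ym <-; split; last exact: (set_mem (valP y)).
exact: (le_trans (ym : val y <= m) mp).
Qed.

End SimplicialFull.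

(* Main.v *)
Require Import Defs.
From mathcomp Require Import all_boot all_order.
From mathcomp Require Import boolp classical_sets.

(** Below [r] the poset [L] is a simplex, so [q < r] has a complementary face
    [q']: every vertex of [r] lies on exactly one of [q] and [q'].  For [p]
    over [r], a simplex [x <= p] over [r] is the join of its parts [x_q] and
    [x_q'] over [q] and [q'], and conversely any [u <= p_q] over [q] and
    [v <= p_q'] over [q'] are the parts of their join, which exists because
    [p] bounds both.  Hence [x |-> (x_q, x_q')] identifies the cone of [p] in
    the fibre of [r] with the product of the cones of [p_q] and [p_q'] in the
    fibres of [q] and [q'], and the Hatcher map becomes the first projection.
    A cone is a poset with a greatest element, hence of the form [CX].

    Two faces of a common simplex are compared through their vertices (minimal
    elements), using [simplicial_vertex_notin].  The facts about [f] that carry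
    the argument are that it preserves joins ([simplicial_map_sup]) and hence
    that [x_q] dominates everything below [x] that [f] sends below [q]
    ([le_hatcher]); bijectivity of the pairing is [hatcher_pair_mono] and
    [hatcher_pair_surjective]. *)

Set Implicit Arguments.
Unset Strict Implicit.
Unset Printing Implicit Defensive.

Import Order.TTheory.
Local Open Scope order_scope.
Local Open Scope classical_set_scope.

(** * Order isomorphisms and cones *)

Lemma mono_surjective_iso (d d' : Order.disp_t)
    (P : porderType d) (Q : porderType d') (phi : P -> Q) :
  {mono phi : x y / x <= y} -> (forall y, exists x, phi x = y) -> is_iso phi.
Proof.
move=> mphi sphi; split=> //.
have phiK y : phi (sval (cid (sphi y))) = y by case: cid.
by exists (fun y => sval (cid (sphi y))) => // x; apply: (inc_inj mphi).
Qed.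

Definition cone_to_with_top (d : Order.disp_t) (T : porderType d) (t : T)
    (x : cone t) : with_top {y : T | y < t} := insub (val x).

Lemma cone_to_with_top_iso (d : Order.disp_t) (T : porderType d) (t : T) :
  is_iso (@cone_to_with_top d T t).
Proof.
have le_top (x : cone t) : val x <= t by exact: (set_mem (valP x)).
have eq_top (x : cone t) : ~~ (val x < t) -> val x = t.
  by move=> nx; apply/eqP; have := le_top x; rewrite le_eqVlt (negPf nx) orbF.
apply: mono_surjective_iso => [x y|[y|]].
- rewrite /cone_to_with_top -[RHS]/(val x <= val y).
  case: insubP => [u _ <-|/eq_top ->]; case: insubP => [v vt vy|/eq_top ->].
  + by rewrite -vy.
  + by apply: esym; exact: (ltW (valP u)).
  + by apply: esym; rewrite -[RHS]/false lt_geF.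
  + by rewrite !lexx.
- have yt : val y \in cone t by apply/mem_set/ltW; exact: (valP y).
  by exists (exist _ (val y) yt); rewrite /cone_to_with_top valK.
- have tt : t \in cone t by apply/mem_set; exact: lexx.
  by exists (exist _ t tt); rewrite /cone_to_with_top insubF //= ltxx.
Qed.

(** * Complementary faces of a simplex *)

(** In the simplex below [r], the face on the vertices of [r] outside [q] is
    nonempty because [q] is a proper face. *)
Lemma simplicial_complement (d : Order.disp_t) (T : porderType d) (q r : T) :
  simplicial_poset T -> q < r ->
  exists q', [/\ q' < r,
    forall b, minimal b -> b <= r -> b <= q \/ b <= q' &
    forall x, x <= q -> ~ x <= q'].
Proof.
move=> sT qr; have qler := ltW qr.
have [S [A [B [A0 Ale AB]]]] := simplicial_vertices r sT.
have ne : ~` A q !=set0.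
  apply: contrapT => h.
  have : r <= q.
    apply/(Ale _ _ (lexx r) qler) => s _.
    by apply: contrapT => nqs; apply: h; exists s.
  by rewrite (lt_geF qr).
have [q'r Aq'] := AB _ ne.
have disj x : x <= q -> ~ x <= B (~` A q).
  move=> xq xq'; have xr := le_trans xq qler; have [s xs] := A0 _ xr.
  have := (Ale _ _ xr q'r).1 xq' s xs; rewrite Aq'; apply.
  exact: (Ale _ _ xr qler).1 xq s xs.
exists (B (~` A q)); split=> //.
- rewrite lt_neqAle q'r andbT; apply/eqP => e.
  by apply: (disj q) => //; rewrite e.
- move=> b minb br; have [s bs] := A0 _ br.
  have [sr As] := AB [set s] (ex_intro _ s erefl).
  have <- : B [set s] = b.
    by apply: minb; apply/(Ale _ _ sr br); rewrite As => _ ->.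
  have [qs|nqs] := pselect (A q s); [left|right].
  + by apply/(Ale _ _ sr qler); rewrite As => _ ->.
  + by apply/(Ale _ _ sr q'r); rewrite As Aq' => _ ->.
Qed.

Lemma simplicial_join (d : Order.disp_t) (T : porderType d) (u v p : T) :
  simplicial_poset T -> u <= p -> v <= p ->
  exists2 m, supremums [set u; v] m & [/\ u <= m, v <= m & m <= p].
Proof.
move=> sT up vp.
have ubp : ubound [set u; v] p by move=> _ [] ->.
have [m supm] := sT.2 _ (ex_intro _ u (or_introl erefl)) (ex_intro _ p ubp).
exists m => //; have [ubm lbm] := supm.
by split; [apply: ubm; left|apply: ubm; right|exact: lbm].
Qed.

(** * Simplicial maps and joins *)

Lemma closed_map_minimal (d d' : Order.disp_t)
    (P : porderType d) (Q : porderType d') (f : {omorphism P -> Q}) (a : P) :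
  closed_map f -> minimal a -> minimal (f a).
Proof.
move=> cf mina b ba; have : (f @` cone a) b by rewrite cf.
by case=> c ca <-; rewrite (mina c ca).
Qed.

(** Since [f] is closed, a vertex of [f m] is the image of a vertex of [m],
    which lies below some member of [X]. *)
Lemma simplicial_map_sup (d d' : Order.disp_t)
    (P : porderType d) (Q : porderType d') (f : {omorphism P -> Q})
    (X : set P) (m : P) :
  simplicial_map f -> X !=set0 -> supremums X m ->
  supremums (f @` X) (f m).
Proof.
case=> sP sQ cf X0 supm.
have ubfm : ubound (f @` X) (f m).
  by move=> _ [x Xx <-]; apply: omorph_le; exact: supm.1.
split=> // z ubz.
(* [z] and [f m] need not have a common upper bound, so vertices are compared
   with the join [n] of the image, which lies below both. *)
have fX0 : (f @` X) !=set0 by case: X0 => x Xx; exists (f x); exists x.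
have [n [ubn lbn]] := sQ.2 _ fX0 (ex_intro _ _ ubfm).
apply: le_trans (lbn _ ubz); apply: contrapT => nmn.
have [v [minv vm nvn]] := simplicial_vertex_notin sQ (lexx _) (lbn _ ubfm) nmn.
have : (f @` cone m) v by rewrite cf.
case=> b bm fb; have [a [mina ab]] := simplicial_vertex b sP.
have fav : f a = v by apply: minv; rewrite -fb; exact: omorph_le.
have [x Xx ax] := simplicial_vertex_sup sP X0 supm mina (le_trans ab bm).
apply: nvn; rewrite -fav; apply: le_trans (omorph_le f ax) _.
by apply: ubn; exists x.
Qed.

(** * The Hatcher maps of a simplicial map *)

Lemma fibreE (d d' : Order.disp_t) (P : porderType d) (Q : porderType d')
    (f : {omorphism P -> Q}) (q : Q) (x : fibre f q) : f (val x) = q.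
Proof. exact: (set_mem (valP x)). Qed.

Section HatcherSimplicial.
Context (dK dL : Order.disp_t) (K : porderType dK) (L : porderType dL).
Context (f : {omorphism K -> L}) (f_simplicial : simplicial_map f) (r : L).

Let sK : simplicial_poset K. Proof. by case: f_simplicial. Qed.
Let sL : simplicial_poset L. Proof. by case: f_simplicial. Qed.
Let cf : closed_map f. Proof. by case: f_simplicial. Qed.

Let h (q : L) (qr : q < r) : {omorphism fibre f r -> fibre f q} :=
  hatcher (simplicial_map_closed f_simplicial)
          (simplicial_map_full f_simplicial) qr.

Lemma hatcher_le (q : L) (qr : q < r) (x : fibre f r) :
  val (h qr x) <= val x.
Proof.
have : (val @` cone (h qr x)) (val (h qr x)).
  by exists (h qr x) => //; exact: lexx.
by rewrite -hatcher_funP => -[].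
Qed.

(** The join of [y] with [x_q] is still below [x], and still over [q] because
    [f] preserves joins; maximality of [x_q] then absorbs [y]. *)
Lemma le_hatcher (q : L) (qr : q < r) (x : fibre f r) (y : K) :
  y <= val x -> f y <= q -> y <= val (h qr x).
Proof.
move=> yx fyq.
have [m supm [ym xm mx]] := simplicial_join sK yx (hatcher_le qr x).
apply: le_trans ym _.
have fm : f m = q.
  apply/le_anti; rewrite -[X in X <= f m](fibreE (h qr x)) omorph_le // andbT.
  have ne : [set y; val (h qr x)] !=set0 by exists y; left.
  apply: (simplicial_map_sup f_simplicial ne supm).2.
  by move=> _ [_ [->|->] <-] //; rewrite fibreE.
have [z zh <-] : (val @` cone (h qr x)) m by rewrite -hatcher_funP; split.
exact: zh.
Qed.

(** Every vertex of [x] maps to a vertex of [r], hence belongs to one of the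
    two parts of [x]; so the parts determine [x] among the faces of [p]. *)
Lemma hatcher_pair_mono (q q' : L) (qr : q < r) (q'r : q' < r)
    (p x y : fibre f r) :
  (forall b, minimal b -> b <= r -> b <= q \/ b <= q') -> x <= p -> y <= p ->
  (x <= y) = (h qr x <= h qr y) && (h q'r x <= h q'r y).
Proof.
move=> q_cover xp yp; apply/idP/andP => [xy|[hxy h'xy]].
  by split; exact: omorph_le.
rewrite -[x <= y]/(val x <= val y).
apply: contrapT => nxy.
have [a [mina ax nay]] := simplicial_vertex_notin sK xp yp nxy.
have far : f a <= r by rewrite -(fibreE x) omorph_le.
apply: nay; have [fq|fq'] := q_cover _ (closed_map_minimal cf mina) far.
- apply: le_trans (le_hatcher qr ax fq) _.
  exact: le_trans (hxy : val (h qr x) <= val (h qr y)) (hatcher_le qr y).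
- apply: le_trans (le_hatcher q'r ax fq') _.
  exact: le_trans (h'xy : val (h q'r x) <= val (h q'r y)) (hatcher_le q'r y).
Qed.

(** A vertex of the join [x] over [q] lies on [u] or on [v], and not on [v]
    since [q] and [q'] are disjoint. *)
Lemma hatcher_join (q q' : L) (qr : q < r) (u v : K) (x : fibre f r) :
  (forall y, y <= q -> ~ y <= q') -> f u = q -> f v = q' ->
  supremums [set u; v] (val x) -> val (h qr x) = u.
Proof.
move=> q_disj fu fv supx.
have ux : u <= val x by apply: supx.1; left.
apply/le_anti/andP; split; last by apply: le_hatcher; rewrite ?fu.
have hx := hatcher_le qr x.
apply: contrapT => nhu.
have [a [mina ah nau]] := simplicial_vertex_notin sK hx ux nhu.
have [w [->|->] // av] := simplicial_vertex_sup sK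
  (ex_intro _ u (or_introl erefl)) supx mina (le_trans ah hx).
apply: (q_disj (f a)).
- by rewrite -(fibreE (h qr x)) omorph_le.
- by rewrite -fv omorph_le.
Qed.

(** The join of [u] and [v] maps to the join of [q] and [q'], which is [r]
    because these two faces contain every vertex of [r]. *)
Lemma hatcher_pair_surjective (q q' : L) (qr : q < r) (q'r : q' < r)
    (p : fibre f r) (u : fibre f q) (v : fibre f q') :
  (forall b, minimal b -> b <= r -> b <= q \/ b <= q') ->
  (forall y, y <= q -> ~ y <= q') ->
  u <= h qr p -> v <= h q'r p ->
  exists x, [/\ x <= p, h qr x = u & h q'r x = v].
Proof.
move=> q_cover q_disj uh vh.
have up : val u <= val p := le_trans (uh : val u <= val _) (hatcher_le qr p).
have vp : val v <= val p := le_trans (vh : val v <= val _) (hatcher_le q'r p).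
have [m supm [um vm mp]] := simplicial_join sK up vp.
have fmr : f m <= r by rewrite -(fibreE p) omorph_le.
have fm : f m = r.
  apply/le_anti; rewrite fmr /=; apply: contrapT => nrm.
  have [b [minb br]] := simplicial_vertex_notin sL (lexx r) fmr nrm.
  apply; have [bq|bq'] := q_cover _ minb br.
  - by apply: le_trans bq _; rewrite -(fibreE u) omorph_le.
  - by apply: le_trans bq' _; rewrite -(fibreE v) omorph_le.
pose x : fibre f r := exist _ m (mem_set fm).
exists x; split=> //; apply: val_inj.
- exact: (hatcher_join qr q_disj (fibreE u) (fibreE v)).
- apply: (hatcher_join (q' := q) q'r _ (fibreE v) (fibreE u)).
  + by move=> y yq' yq; exact: q_disj yq yq'.
  + by rewrite setUC.
Qed.

End HatcherSimplicial.

Theorem lemma7p6 (dK dL : Order.disp_t)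
    (K : porderType dK) (L : porderType dL) (f : {omorphism K -> L})
    (f_simplicial : simplicial_map f) (r q : L) (qr : q < r) :
  cubical (hatcher (simplicial_map_closed f_simplicial)
                   (simplicial_map_full f_simplicial) qr).
Proof.
move=> p; have [_ sL _] := f_simplicial.
have [q' [q'r q_cover q_disj]] := simplicial_complement sL qr.
set h := hatcher _ _ qr.
pose h' := hatcher (simplicial_map_closed f_simplicial)
                   (simplicial_map_full f_simplicial) q'r.
exists _, _, {y : fibre f q | y < h p}, {y : fibre f q' | y < h' p}.
have [top_bij top_mono] := cone_to_with_top_iso (h p).
have [[g' _ top_gK'] top_mono'] := cone_to_with_top_iso (h' p).
have [g _ top_gK] := top_bij.
exists (fun x => (cone_to_with_top (cone_restr h x),
                  cone_to_with_top (cone_restr h' x))).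
exists (@cone_to_with_top _ _ (h p)); split=> //.
apply: mono_surjective_iso => [x y|[a b]].
- rewrite leEprod /= top_mono top_mono'.
  have xp : val x <= p := set_mem (valP x).
  have yp : val y <= p := set_mem (valP y).
  by rewrite -[RHS]/(val x <= val y)
    (hatcher_pair_mono f_simplicial qr q'r q_cover xp yp).
- have [x [xp hx hx']] := hatcher_pair_surjective q_cover q_disj
    (set_mem (valP (g a)) : val (g a) <= h p)
    (set_mem (valP (g' b)) : val (g' b) <= h' p).
  exists (exist _ x (mem_set (xp : cone p x))).
  rewrite -[a]top_gK -[b]top_gK'.
  by congr (cone_to_with_top _, cone_to_with_top _); apply: val_inj.
Qed.
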